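(* Let $\alpha > 0$, let $G_\alpha$ be the generalized Grushin plane, equipped with its Carnot-Carathéodory distance $d_{CC}$, and let $\mathbb{R}^2$ carry the Euclidean metric. Let $F: G_\alpha \rightarrow \mathbb{R}^2$ be defined in coordinates by $F(x,y) = (x|x|^{\alpha/2}, y)$. Then $F$ is quasisymmetric.
   Context: Generalized Grushin plane: for $\alpha > 0$, $G_\alpha$ is the metric completion of $\{(x,y) \in \mathbb{R}^2 : x \neq 0\}$ equipped with the Riemannian metric $ds^2 = dx^2 + |x|^{-\alpha}dy^2$. It has the coordinate structure of $\mathbb{R}^2$ (as a set, $G_\alpha = \mathbb{R}^2$), and it is a metric space under the Carnot-Carathéodory distance defined as follows. A vector of $\mathbb{R}^2$ is horizontal if it has the form $(t,0)$ with $t$ real. For $g,h \in G_\alpha$ let $\Gamma_{g,h}$ be the set of all (piecewise continuously differentiable) curves $\gamma = (x(\cdot),y(\cdot)): [0,1] \rightarrow G_\alpha$ with $\gamma(0)=g$, $\gamma(1)=h$, and with $\dot\gamma(t)$ horizontal for each $t \in [0,1]$ such that $\gamma(t)$ lies on the $y$-axis (one-sided derivatives at break points). Then $$d_{CC}(g,h) = \inf_{\gamma \in \Gamma_{g,h}} \int_0^1 \sqrt{(\dot x(t))^2 + |x(t)|^{-\alpha}(\dot y(t))^2}\, dt,$$ where the term $|x(t)|^{-\alpha}(\dot y(t))^2$ is read as $0$ when $x(t)=0$ (where $\dot y(t)=0$). Quasisymmetry: let $(X,d_X)$ and $(Y,d_Y)$ be metric spaces and $f: X \rightarrow Y$ an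 injective map. For an increasing homeomorphism $\eta: (0,\infty) \rightarrow (0,\infty)$, $f$ is $\eta$-quasisymmetric if for all $z_1,z_2,z_3 \in X$ with $z_2 \neq z_1$ and $z_3 \neq z_1$, $$\frac{d_Y(f(z_3),f(z_1))}{d_Y(f(z_2),f(z_1))} \leq \eta\left(\frac{d_X(z_3,z_1)}{d_X(z_2,z_1)}\right).$$ $f$ is quasisymmetric if it is $\eta$-quasisymmetric for some such $\eta$. *)

(* Defs.v *)
From HB Require Import structures.
From mathcomp Require Import all_boot all_order all_algebra.
From mathcomp Require Import all_classical all_reals all_analysis.

Set Implicit Arguments.
Unset Strict Implicit.
Unset Printing Implicit Defensive.

Import Order.TTheory GRing.Theory Num.Theory.
Import numFieldNormedType.Exports.

Local Open Scope classical_set_scope.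
Local Open Scope ring_scope.

(* [eta] represents a self-map of (0, oo); its values outside (0, oo) are
   irrelevant. *)
Definition increasing_homeo_pos (R : realType) (eta : R -> R) : Prop :=
  exists theta : R -> R,
    [/\ {homo eta : t / 0 < t},
        {homo theta : t / 0 < t},
        (forall t : R, 0 < t -> theta (eta t) = t) &
        (forall t : R, 0 < t -> eta (theta t) = t)] /\
    [/\ (forall s t : R, 0 < s -> s < t -> eta s < eta t),
        {within `]0, +oo[, continuous eta} &
        {within `]0, +oo[, continuous theta}].

(* [dX] and [dY] are the distance functions of the metric spaces X and Y. *)
Definition eta_quasisymmetric (R : realType) (X Y : Type)
    (dX : X -> X -> R) (dY : Y -> Y -> R) (eta : R -> R) (f : X -> Y) : Prop :=
  injective f /\
  forall z1 z2 z3 : X, z2 <> z1 -> z3 <> z1 ->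
    dY (f z3) (f z1) / dY (f z2) (f z1) <= eta (dX z3 z1 / dX z2 z1).

Definition quasisymmetric (R : realType) (X Y : Type)
    (dX : X -> X -> R) (dY : Y -> Y -> R) (f : X -> Y) : Prop :=
  exists eta : R -> R,
    increasing_homeo_pos eta /\ eta_quasisymmetric dX dY eta f.

(* The product norm of [R * R] in the library is the sup norm. *)
Definition euclidean_dist (R : realType) (p q : R * R) : R :=
  Num.sqrt ((p.1 - q.1) ^+ 2 + (p.2 - q.2) ^+ 2).

(* [u] is continuously differentiable on the closed interval [a, b] with
   derivative [du], one-sided at the end points: only the restriction of [u]
   to [a, b] matters. *)
Definition C1_on (R : realType) (a b : R) (u du : R -> R) : Prop :=
  {within `[a, b], continuous du} /\
  forall t, t \in `[a, b] ->
    (u s - u t) / (s - t) @[s --> within `[a, b] t^'] --> du t.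

(* The set of curves (x, y) over [0, 1] from [g] to [h] that are C^1 on each
   closed piece of a subdivision of [0, 1] and whose velocity, including both
   one-sided velocities at break points, is horizontal on the y-axis. *)
Definition horizontal_curve (R : realType) (g h : R * R)
    (x y : R -> R) : Prop :=
  [/\ (x 0, y 0) = g, (x 1, y 1) = h &
    exists (n : nat) (s : nat -> R),
      [/\ s 0%N = 0, s n = 1 &
        forall i, (i < n)%N -> s i < s i.+1 /\
          exists dx dy : R -> R,
            [/\ C1_on (s i) (s i.+1) x dx, C1_on (s i) (s i.+1) y dy &
              forall t, t \in `[s i, s i.+1] -> x t = 0 -> dy t = 0]]].

(* The integrand uses two-sided derivatives, hence is meaningful off the
   finitely many break points.  As [0 `^ (- alpha) = 0], the second term
   vanishes where [x t = 0].  The integrand may be unbounded and the length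
   infinite, hence the extended real value. *)
Definition CC_length (R : realType) (alpha : R) (x y : R -> R) : \bar R :=
  (\int[lebesgue_measure]_(t in `[0%R, 1%R])
    (Num.sqrt ((derive1 x t) ^+ 2 + `|x t| `^ (- alpha) * (derive1 y t) ^+ 2))%:E)%E.

Definition CC_edist (R : realType) (alpha : R) (g h : R * R) : \bar R :=
  ereal_inf [set l | exists x y : R -> R,
    horizontal_curve g h x y /\ l = CC_length alpha x y].

(* For [0 < alpha] any two points are joined by a horizontal curve of finite
   length, so that [fine] only forgets that the infimum is finite. *)
Definition CC_dist (R : realType) (alpha : R) (g h : R * R) : R :=
  fine (CC_edist alpha g h).

Definition grushin_map (R : realType) (alpha : R) (p : R * R) : R * R :=
  (p.1 * `|p.1| `^ (alpha / 2), p.2).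

(* Main.v *)
(* With b = alpha/2 and u = x|x|^b, the map F turns the Grushin metric, up to
   constants, into the conformal metric |u|^(-t) |dz| with t = b/(1+b) < 1.  Hence
   d_CC(g, h) is comparable to phi(D) = D max(|u_h|, D)^(-t), D = |F g - F h|.
   From below: a curve of length L ending at h stays in |x| <= |x_h| + 2L, where
   |du| and |dy| are at most (1+b) (|x_h| + 2L)^b times the length element, so
   D <= (1+b) (|x_h| + 2L)^b 2L.  From above: move horizontally to a suitable
   abscissa c <> 0, then vertically, then horizontally.
   Since phi depends on the base point h only through |u_h|, a bound
   phi(D3) <= T phi(D2) gives D3/D2 <= max(T, T^(1+b)), so F is quasisymmetric
   with eta(t) = max(C t, (C t)^(1+b)). *)
Require Import Defs.
From mathcomp Require Import all_boot all_order all_algebra.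
From mathcomp Require Import all_classical all_reals all_analysis.
From mathcomp Require Import measurable_realfun ring lra.

Set Implicit Arguments.
Unset Strict Implicit.
Unset Printing Implicit Defensive.

Import Order.TTheory GRing.Theory Num.Theory.
Import numFieldNormedType.Exports.

Local Open Scope classical_set_scope.
Local Open Scope ring_scope.

(** * Variation of piecewise C1 functions *)

Lemma C1_on_sub (R : realType) (a b a' b' : R) (u du : R -> R) :
  a <= a' -> b' <= b -> C1_on a b u du -> C1_on a' b' u du.
Proof.
move=> aa' bb' [cdu Du].
have sub : [set` `[a', b']] `<=` [set` `[a, b]].
  by apply: subset_itv; rewrite bnd_simp.
split; first exact: continuous_subspaceW cdu.
move=> t tab'; apply: cvg_trans (Du t (sub _ tab')).
apply: cvg_app => A HA; move: HA; rewrite !nbhs_simpl /within /=.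
by apply: filterS => s As /sub; exact: As.
Qed.

Lemma C1_on_continuous (R : realType) (a b : R) (u du : R -> R) :
  C1_on a b u du -> {within `[a, b], continuous u}.
Proof.
move=> [_ Du]; apply/subspace_continuousP => t tab.
(* Writing [u s] as quotient times [s - t] plus [u t] gives the limit along [s != t]; the point
   [s = t] is handled separately below. *)
have lim0 : (u s - u t) / (s - t) * (s - t) + u t @[s --> within `[a, b] t^'] --> u t.
  rewrite -[X in _ --> X]add0r -(mulr0 (du t)).
  apply: cvgD; last exact: cvg_cst.
  apply: cvgM; first exact: Du.
  rewrite -(subrr t); apply: cvgB; last exact: cvg_cst.
  apply: cvg_trans (_ : s @[s --> t^'] --> t).
    exact: cvg_within.
  exact: nbhs_dnbhs.
apply/cvgrPdist_lt => e e0.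
move/cvgrPdist_lt/(_ e e0): lim0 => H.
have {}H : \forall s \near t, s != t -> s \in `[a, b] ->
    `|u t - ((u s - u t) / (s - t) * (s - t) + u t)| < e by exact: H.
rewrite near_withinE; apply: filterS H => s H sab.
have [->|st] := eqVneq s t; first by rewrite subrr normr0.
have := H st sab.
by rewrite divfK ?subr_eq0// subrK.
Qed.

(** Near an interior point the constraint [s \in [a, b]] is void, so the one-sided derivative is the
    two-sided one used in [CC_length]. *)
Lemma C1_on_derive (R : realType) (a b : R) (u du : R -> R) (t : R) :
  C1_on a b u du -> t \in `]a, b[ -> is_derive t 1 u (du t).
Proof.
move=> [_ Du] tab.
have D : h^-1 *: ((u \o shift t) (h *: 1) - u t) @[h --> 0^'] --> du t.
  apply/cvgrPdist_lt => e e0.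
  have := Du t (subset_itv_oo_cc tab).
  move/cvgrPdist_lt/(_ e e0) => H.
  have {}H : \forall s \near t, s != t -> s \in `[a, b] ->
    `|du t - (u s - u t) / (s - t)| < e by exact: H.
  have H' : \forall s \near t, s != t ->
     `|du t - (u s - u t) / (s - t)| < e.
    apply: filterS2 (near_in_itvoo tab) H => s sab H st.
    by apply: H => //; exact: subset_itv_oo_cc.
  move: H'; rewrite nbhs0P.
  apply: filterS => h Hh h0.
  have := Hh; rewrite addrC addrK -subr_eq0 addrK => /(_ h0).
  by rewrite /= [h *: 1]mulr1 mulrC.
apply: DeriveDef; first by apply/cvg_ex; exists (du t).
exact: cvg_lim.
Qed.

(** By the fundamental theorem of calculus the increment is the integral of [du]. The bound on [du]
    is asked only inside the interval, as two-sided derivatives may fail at the end points, which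
    form a null set. *)
Lemma C1_on_variation (R : realType) (a b M : R) (u du f : R -> R) :
  a < b -> C1_on a b u du -> (forall t, 0 <= f t) -> 0 <= M ->
  measurable_fun `]a, b[ f ->
  (forall t, t \in `]a, b[ -> `|du t| <= M * f t) ->
  (`|u b - u a|%:E <= M%:E * \int[lebesgue_measure]_(t in `[a, b]) (f t)%:E)%E.
Proof.
move=> ab Cu f0 M0 mf duf.
have cdu := Cu.1.
have /(continuous_within_itvP _ ab) [_ ua ub] := C1_on_continuous Cu.
have FTC := @continuous_FTC2 _ du u a b ab cdu.
rewrite -EFinD in FTC.
have mdu : measurable_fun `[a, b] du by exact: subspace_continuous_measurable_fun.
have mdu' : measurable_fun `]a, b[ du.
  by apply: measurable_funS mdu => //; exact: subset_itv_oo_cc.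
rewrite -abse_EFin -FTC; last 2 first.
- by split => // t /(C1_on_derive Cu) [].
- by move=> t /(C1_on_derive Cu) [_ <-]; rewrite derive1E.
rewrite (@integral_itv_bndoo _ _ _ (fun t => (du t)%:E)); last exact/measurable_EFinP.
rewrite (@integral_itv_bndoo _ _ _ (fun t => (f t)%:E)); last exact/measurable_EFinP.
apply: le_trans (le_abse_integral _ _ _) _ => //; first exact/measurable_EFinP.
rewrite -ge0_integralZl_EFin //; last 2 first.
- by move=> t _; rewrite lee_fin.
- exact/measurable_EFinP.
apply: ge0_le_integral => //.
- by apply/measurable_EFinP; exact: measurableT_comp.
- by apply/measurable_EFinP; exact: measurable_funM.
Qed.

Lemma integral_itv_split (R : realType) (f : R -> R) (a b c : R) :
  (forall t, 0 <= f t) -> a <= b -> b <= c ->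
  measurable_fun `[a, b] f -> measurable_fun `]b, c] f ->
  (\int[lebesgue_measure]_(t in `[a, c]) (f t)%:E =
   \int[lebesgue_measure]_(t in `[a, b]) (f t)%:E +
   \int[lebesgue_measure]_(t in `[b, c]) (f t)%:E)%E.
Proof.
move=> f0 ab bc mab mbc.
have E := @itv_bndbnd_setU _ _ (BLeft a) (BRight b) (BRight c).
have mac : measurable_fun `[a, c] f.
  by rewrite E ?bnd_simp //; apply/measurable_funU.
rewrite E ?bnd_simp //.
rewrite ge0_integral_setU //.
- congr (_ + _)%E; rewrite integral_itv_obnd_cbnd //; exact/measurable_EFinP.
- by rewrite -E ?bnd_simp //; exact/measurable_EFinP.
- by move=> x _; rewrite lee_fin.
- apply/disj_setPLR => x /=; rewrite !in_itv/= => /andP[_ xs].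
  by rewrite ltNge xs.
Qed.

Lemma measurable_subdivision (R : realType) (f : R -> R) (n : nat) (s : nat -> R) :
  (forall i, (i < n)%N -> s i < s i.+1) ->
  (forall i, (i < n)%N -> measurable_fun `]s i, s i.+1[ f) ->
  measurable_fun `[s 0%N, s n] f /\ s 0%N <= s n.
Proof.
elim: n => [|n IHn] inc mf.
  by rewrite set_itv1; split => //; exact: measurable_fun_set1.
have [m0n le0n] : measurable_fun `[s 0%N, s n] f /\ s 0%N <= s n.
  by apply: IHn => i /leqW; [exact: inc|exact: mf].
have lt := inc n (ltnSn n).
split; last exact: le_trans (ltW lt).
rewrite (@itv_bndbnd_setU _ _ _ (BRight (s n))) ?bnd_simp //; last exact: ltW.
apply/measurable_funU => //; split => //.
apply/measurable_fun_itv_bndo_bndcP.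
by apply: mf.
Qed.

(** Sums the estimate over the pieces. It is stated for every intermediate time [t] because it also
    serves to confine a whole curve to a strip. *)
Lemma subdivision_variation (R : realType) (M : R) (u f : R -> R)
    (n : nat) (s : nat -> R) :
  (forall t, 0 <= f t) -> 0 <= M ->
  (forall i, (i < n)%N -> s i < s i.+1) ->
  (forall i, (i < n)%N -> measurable_fun `]s i, s i.+1[ f) ->
  (forall i, (i < n)%N -> exists2 du, C1_on (s i) (s i.+1) u du &
     forall t, t \in `]s i, s i.+1[ -> `|du t| <= M * f t) ->
  forall t, t \in `[s 0%N, s n] ->
  (`|u t - u (s 0%N)|%:E <=
     M%:E * \int[lebesgue_measure]_(t in `[s 0%N, s n]) (f t)%:E)%E.
Proof.
move=> f0 M0 inc mf Hu.
have I0 (D : set R) : (0 <= M%:E * \int[lebesgue_measure]_(t in D) (f t)%:E)%E.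
  by rewrite mule_ge0 ?lee_fin// integral_ge0// => t _; rewrite lee_fin.
elim: n inc mf Hu => [|n IHn] inc mf Hu t.
  by rewrite in_itv/= -eq_le => /eqP <-; rewrite subrr normr0.
have {}IHn : forall t, t \in `[s 0%N, s n] -> (`|u t - u (s 0%N)|%:E <=
     M%:E * \int[lebesgue_measure]_(t in `[s 0%N, s n]) (f t)%:E)%E.
  by apply: IHn => i /leqW; [exact: inc|exact: mf|exact: Hu].
have [mn le0n] := @measurable_subdivision _ f n s
   (fun i (h : (i < n)%N) => inc i (leqW h)) (fun i h => mf i (leqW h)).
have [mSn _] := @measurable_subdivision _ f n.+1 s inc mf.
have lt := inc n (ltnSn n).
have mlast : measurable_fun `]s n, s n.+1] f.
  by apply/measurable_fun_itv_bndo_bndcP; exact: mf.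
have split_int : (\int[lebesgue_measure]_(t in `[s 0%N, s n.+1]) (f t)%:E =
   \int[lebesgue_measure]_(t in `[s 0%N, s n]) (f t)%:E +
   \int[lebesgue_measure]_(t in `[s n, s n.+1]) (f t)%:E)%E.
  by apply: integral_itv_split => //; exact: ltW.
rewrite split_int ge0_muleDr; try by apply: integral_ge0 => x _; rewrite lee_fin.
rewrite in_itv/= => /andP[t0 t1].
have [tn|tn] := leP t (s n).
  apply: le_trans (IHn t _) _; first by rewrite in_itv/= t0.
  by rewrite leeDl.
have {}IHn := IHn (s n); rewrite in_itv/= lexx le0n in IHn.
have {}IHn := IHn isT.
have -> : u t - u (s 0%N) = (u (s n) - u (s 0%N)) + (u t - u (s n)) by ring.
apply: le_trans (_ : `|u (s n) - u (s 0%N)|%:E + `|u t - u (s n)|%:E <= _)%E.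
  by rewrite -EFinD lee_fin ler_normD.
apply: leeD => //.
have [du Cu dub] := Hu n (ltnSn n).
apply: le_trans (_ : M%:E * \int[lebesgue_measure]_(t in `[s n, t]) (f t)%:E <= _)%E.
  apply: C1_on_variation (C1_on_sub _ _ Cu) _ _ _ _ => //.
  - by apply: measurable_funS mlast => //; apply: subset_itv; rewrite bnd_simp// ltW.
  - move=> x; rewrite in_itv/= => /andP[x1 x2]; apply: dub.
    by rewrite in_itv/= x1 (lt_le_trans x2).
rewrite lee_wpmul2l ?lee_fin //.
apply: ge0_subset_integral => //.
- by apply/measurable_EFinP/measurable_fun_itv_obnd_cbndP.
- by move=> x _; rewrite lee_fin.
- by apply: subset_itv; rewrite bnd_simp.
Qed.

(** * Lengths of horizontal curves *)

(** The integrand of [CC_length], in the role of [f] in the variation estimates. *)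
Definition grushin_speed (R : realType) (alpha : R) (x y : R -> R) (t : R) : R :=
  Num.sqrt ((derive1 x t) ^+ 2 + `|x t| `^ (- alpha) * (derive1 y t) ^+ 2).

Lemma measurable_grushin_speed (R : realType) (alpha a b : R) (x dx y dy : R -> R) :
  a < b -> C1_on a b x dx -> C1_on a b y dy ->
  measurable_fun `]a, b[ (grushin_speed alpha x y).
Proof.
move=> ab Cx Cy.
have meas (u : R -> R) : {within `[a, b], continuous u} -> measurable_fun `]a, b[ u.
  move=> cu; apply: measurable_funS (subspace_continuous_measurable_fun _ cu) => //.
  exact: subset_itv_oo_cc.
have md (u du : R -> R) : C1_on a b u du -> measurable_fun `]a, b[ (derive1 u).
  move=> Cu; apply: eq_measurable_fun (meas _ Cu.1) => t; rewrite inE /= => tab.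
  by have [_ <-] := C1_on_derive Cu tab; rewrite derive1E.
have mx := meas _ (C1_on_continuous Cx).
have mN : measurable_fun `]a, b[ (fun t => `|x t|).
  exact: (measurableT_comp (@normr_measurable _ setT) mx).
have mP : measurable_fun `]a, b[ (fun t => `|x t| `^ (- alpha)).
  exact: (measurableT_comp (measurable_powR (- alpha)) mN).
have msqrt := continuous_measurable_fun (@sqrt_continuous R).
apply: (measurableT_comp msqrt).
apply: measurable_funD.
  by apply: measurable_funX; exact: md Cx.
apply: measurable_funM => //.
by apply: measurable_funX; exact: md Cy.
Qed.

Lemma powRN_half_sqr (R : realType) (alpha z : R) :
  z `^ (- alpha) = (z `^ (- (alpha / 2))) ^+ 2.
Proof.
(* By the conventions for powers of 0, both sides are 1 if [alpha = 0] and 0 otherwise. *)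
have [->|z0] := eqVneq z 0.
  have [->|a0] := eqVneq alpha 0; first by rewrite mul0r oppr0 !powRr0 expr1n.
  rewrite !powR0 ?expr0n ?oppr_eq0 //.
  by rewrite mulf_neq0 // invr_neq0 // pnatr_eq0.
rewrite expr2 -powRD ?z0 ?implybT //; congr (_ `^ _); lra.
Qed.

(** The speed dominates [|x'|], so the curve stays in the strip [|x| <= |g.1| + l]. In that strip
    [|y'|] is at most [(|g.1| + l)^(alpha/2)] times the speed. *)
Lemma horizontal_curve_bounds (R : realType) (alpha : R) (g h : R * R)
    (x y : R -> R) (l : R) :
  0 < alpha -> horizontal_curve g h x y -> CC_length alpha x y = l%:E ->
  [/\ 0 <= l, `|h.1 - g.1| <= l &
      `|h.2 - g.2| <= (`|g.1| + l) `^ (alpha / 2) * l].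
Proof.
move=> alpha0 [<- <- [n [s [s0 sn P]]]] Ll /=.
pose f := grushin_speed alpha x y.
have f0 t : 0 <= f t by exact: sqrtr_ge0.
have lE : (\int[lebesgue_measure]_(t in `[s 0%N, s n]) (f t)%:E)%E = l%:E.
  by rewrite s0 sn.
have l0 : 0 <= l.
  by rewrite -lee_fin -lE; apply: integral_ge0 => t _; rewrite lee_fin.
have inc i : (i < n)%N -> s i < s i.+1 by move=> /P [].
have mf i : (i < n)%N -> measurable_fun `]s i, s i.+1[ f.
  move=> /P [lt [dx [dy [Cx Cy _]]]]; exact: measurable_grushin_speed lt Cx Cy.
have xl t : t \in `[s 0%N, s n] -> `|x t - x 0| <= l.
  move=> ts.
  have := @subdivision_variation _ 1 x f n s f0 ler01 inc mf _ t ts.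
  rewrite lE mul1e lee_fin s0; apply => i /P [lt [dx [dy [Cx Cy _]]]].
  exists dx => // r rs; rewrite mul1r.
  have [_ <-] := C1_on_derive Cx rs; rewrite -derive1E -sqrtr_sqr.
  by rewrite ler_wsqrtr // lerDl mulr_ge0 ?powR_ge0 ?sqr_ge0.
have s0n : s 0%N <= s n by rewrite s0 sn ler01.
have x1 : `|x 1 - x 0| <= l by apply: xl; rewrite -sn in_itv/= s0n lexx.
split => //.
pose M := (`|x 0| + l) `^ (alpha / 2).
have M0 : 0 <= M by exact: powR_ge0.
have := @subdivision_variation _ M y f n s f0 M0 inc mf _ 1.
rewrite lE -EFinM lee_fin s0; apply; last by rewrite -sn in_itv/= lexx -s0 s0n.
move=> i ilt; have [lt [dx [dy [Cx Cy hor]]]] := P _ ilt.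
exists dy => // r rs.
have rcc := subset_itv_oo_cc rs.
(* On the y-axis the weight is 0 by convention and the speed does not control [dy]; horizontality
   gives [dy r = 0] instead. *)
have [xr|xr] := eqVneq (x r) 0; first by rewrite hor // normr0 mulr_ge0.
have xMr : `|x r| <= `|x 0| + l.
  rewrite -lerBlDl; apply: le_trans (xl r _); first exact: lerB_dist.
  have mono : forall j k : nat, (j <= k)%N -> (k <= n)%N -> s j <= s k.
    move=> j; elim => [|k IH]; first by rewrite leqn0 => /eqP ->.
    rewrite leq_eqVlt => /orP[/eqP -> //|jk] kn.
    by apply: le_trans (ltW (inc _ kn)); apply: IH => //; exact: ltnW.
  move: rcc; rewrite !in_itv/= => /andP[r1 r2]; apply/andP; split.
    by apply: le_trans r1; apply: mono => //; exact: ltnW.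
  by apply: le_trans r2 _; exact: mono.
have [_ <-] := C1_on_derive Cy rs; rewrite -derive1E.
have xp : 0 < `|x r| `^ (alpha / 2) by apply: powR_gt0; rewrite normr_gt0.
(* Dropping the [x'] term under the root leaves [|x|^(-alpha/2) |y'| <= f]. *)
apply: le_trans (_ : `|x r| `^ (alpha / 2) * f r <= _).
  rewrite -ler_pdivrMl // -powRN -[leLHS]ger0_norm; last first.
    by rewrite mulr_ge0 ?powR_ge0.
  rewrite -sqrtr_sqr ler_wsqrtr //.
  rewrite exprMn -powRN_half_sqr real_normK ?num_real // lerDr sqr_ge0 //.
rewrite ler_wpM2r //; apply: ge0_ler_powR; rewrite ?nnegrE ?addr_ge0 //.
by rewrite divr_ge0 // ltW.
Qed.

(** * Explicit three-leg curves *)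

Lemma C1_on_affine (R : realType) (a b k m : R) (u : R -> R) :
  (forall t, t \in `[a, b] -> u t = k * t + m) -> C1_on a b u (fun=> k).
Proof.
move=> uE; split; first by apply: continuous_subspaceT => t; exact: cvg_cst.
move=> t tab; apply/cvgrPdist_lt => e e0.
have H : \forall s \near t, s != t -> s \in `[a, b] ->
    `|k - (u s - u t) / (s - t)| < e.
  near=> s => st sab; rewrite !uE //.
  have -> : k * s + m - (k * t + m) = k * (s - t) by ring.
  by rewrite mulfK ?subr_eq0 // subrr normr0.
exact: H.
Unshelve. all: by end_near. Qed.

(** Affine interpolation of [z0], [z1], [z2], [z3] at the times 0, 1/3, 2/3, 1. *)
Definition polyline3 (R : realType) (z0 z1 z2 z3 t : R) : R :=
  if t <= 3^-1 then z0 + 3 * t * (z1 - z0)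
  else if t <= 2 / 3 then z1 + (3 * t - 1) * (z2 - z1)
  else z2 + (3 * t - 2) * (z3 - z2).

Lemma C1_on_polyline3 (R : realType) (z0 z1 z2 z3 : R) :
  let u := polyline3 z0 z1 z2 z3 in
  [/\ C1_on 0 3^-1 u (fun=> 3 * (z1 - z0)),
      C1_on 3^-1 (2 / 3) u (fun=> 3 * (z2 - z1)) &
      C1_on (2 / 3) 1 u (fun=> 3 * (z3 - z2))].
Proof.
split.
- apply: (@C1_on_affine _ _ _ _ z0) => t; rewrite in_itv/= => /andP[t0 t1].
  by rewrite /polyline3 t1; ring.
- apply: (@C1_on_affine _ _ _ _ (2 * z1 - z2)) => t; rewrite in_itv/= => /andP[t0 t1].
  (* At the break point the test still selects the preceding branch, so the two affine formulas must
     be seen to agree there. *)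
  rewrite /polyline3 t1; case: ifPn => [t2|_]; last by ring.
  have -> : t = 3^-1 by lra.
  by field.
- apply: (@C1_on_affine _ _ _ _ (3 * z2 - 2 * z3)) => t.
  rewrite in_itv/= => /andP[t0 t1].
  rewrite /polyline3 ifF; last by apply/negbTE; rewrite -ltNge; lra.
  case: ifPn => [t2|_]; last by ring.
  have -> : t = 2 / 3 by lra.
  by field.
Qed.

Lemma integral_cst_oo (R : realType) (f : R -> R) (a b k : R) :
  a < b -> (forall t, t \in `]a, b[ -> f t = k) ->
  measurable_fun `]a, b[ f /\
  (\int[lebesgue_measure]_(t in `[a, b]) (f t)%:E = (k * (b - a))%:E)%E.
Proof.
move=> ab fk.
have mf : measurable_fun `]a, b[ f.
  apply: (@eq_measurable_fun _ _ _ _ _ (cst k)) => [t|]; last exact: measurable_cst.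
  by rewrite inE /= => /fk.
split => //.
rewrite (@integral_itv_bndoo _ _ _ (fun t => (f t)%:E)); last exact/measurable_EFinP.
rewrite (eq_integral (cst k%:E)); last by move=> t; rewrite inE /= => /fk ->.
by rewrite integral_cst //= lebesgue_measure_itv /= lte_fin ab.
Qed.

(** The curve goes horizontally to abscissa [c], vertically at that abscissa, then horizontally to
    [h]; the three terms are the lengths of the legs. The vertical leg avoids the y-axis because
    [c != 0]. *)
Lemma horizontal_curve_detour (R : realType) (alpha : R) (g h : R * R) (c : R) :
  c != 0 -> exists x y : R -> R, horizontal_curve g h x y /\
    CC_length alpha x y =
      (`|c - g.1| + `|c| `^ (- (alpha / 2)) * `|h.2 - g.2| + `|h.1 - c|)%:E.
Proof.
case: g h => [x1 y1] [x2 y2] /= c0.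
pose x := polyline3 x1 c c x2; pose y := polyline3 y1 y1 y2 y2.
exists x, y.
have [Cx0 Cx1 Cx2] := C1_on_polyline3 x1 c c x2.
have [Cy0 Cy1 Cy2] := C1_on_polyline3 y1 y1 y2 y2.
have i0 : 0 < 3^-1 :> R by lra.
have i1 : 3^-1 < 2 / 3 :> R by lra.
have i2 : 2 / 3 < 1 :> R by lra.
have xc t : t \in `[3^-1, 2 / 3] -> x t = c.
  rewrite in_itv/= => /andP[t0 t1]; rewrite /x /polyline3 t1 subrr mulr0 addr0.
  case: ifPn => // t2; have -> : t = 3^-1 by lra.
  by field.
split.
  split.
  - by rewrite /x /y /polyline3 invr_ge0 ler0n mulr0 !mul0r !addr0.
  - rewrite /x /y /polyline3 !ifF; try by apply/negbTE; rewrite -ltNge; lra.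
    by congr (_, _); ring.
  - exists 3%N, (fun i => i%:R / 3); split; first by rewrite mul0r.
      by rewrite divff.
    have e1 : 1 / 3 = 3^-1 :> R by rewrite mul1r.
    have e3 : 3 / 3 = 1 :> R by rewrite divff.
    move=> [|[|[|//]]] _; rewrite ?mul0r ?e1 ?e3; split => //.
    + exists (fun=> 3 * (c - x1)), (fun=> 3 * (y1 - y1)); split => //.
      by move=> *; rewrite subrr mulr0.
    + exists (fun=> 3 * (c - c)), (fun=> 3 * (y2 - y1)); split => //.
      by move=> t /xc -> /eqP; rewrite (negbTE c0).
    + exists (fun=> 3 * (x2 - c)), (fun=> 3 * (y2 - y2)); split => //.
      by move=> *; rewrite subrr mulr0.
pose f := grushin_speed alpha x y.
have f0 t : 0 <= f t by exact: sqrtr_ge0.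
(* The factor 3 in the speed of each leg cancels against its duration 1/3. *)
have sp (a b k m : R) t : C1_on a b x (fun=> 3 * k) -> C1_on a b y (fun=> 3 * m) ->
    t \in `]a, b[ -> f t = 3 * Num.sqrt (k ^+ 2 + `|x t| `^ (- alpha) * m ^+ 2).
  move=> Cx Cy tab; rewrite /f /grushin_speed !derive1E.
  have [_ ->] := C1_on_derive Cx tab; have [_ ->] := C1_on_derive Cy tab.
  have -> : (3 * k) ^+ 2 + `|x t| `^ (- alpha) * (3 * m) ^+ 2 =
    3 ^+ 2 * (k ^+ 2 + `|x t| `^ (- alpha) * m ^+ 2) by ring.
  by rewrite sqrtrM ?sqr_ge0 // sqrtr_sqr ger0_norm.
have [m0 I0] : measurable_fun (`]0, 3^-1[ : set R) f /\
    (\int[lebesgue_measure]_(t in `[0%R, 3^-1%R]) (f t)%:E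
      = (3 * `|c - x1| * (3^-1 - 0))%:E)%E.
  apply: integral_cst_oo => // t /(sp _ _ _ _ _ Cx0 Cy0) ->.
  by rewrite subrr expr0n mulr0 addr0 sqrtr_sqr.
have [m1 I1] : measurable_fun (`]3^-1, 2 / 3[ : set R) f /\
    (\int[lebesgue_measure]_(t in `[3^-1%R, (2 / 3)%R]) (f t)%:E
      = (3 * (`|c| `^ (- (alpha / 2)) * `|y2 - y1|) * (2 / 3 - 3^-1))%:E)%E.
  apply: integral_cst_oo => // t tI; rewrite (sp _ _ _ _ _ Cx1 Cy1 tI).
  rewrite xc ?(subset_itv_oo_cc tI) // subrr expr0n add0r powRN_half_sqr -exprMn.
  by rewrite sqrtr_sqr normrM [`|_ `^ _|]ger0_norm ?powR_ge0.
have [m2 I2] : measurable_fun (`]2 / 3, 1[ : set R) f /\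
    (\int[lebesgue_measure]_(t in `[(2 / 3)%R, 1%R]) (f t)%:E
      = (3 * `|x2 - c| * (1 - 2 / 3))%:E)%E.
  apply: integral_cst_oo => // t /(sp _ _ _ _ _ Cx2 Cy2) ->.
  by rewrite subrr expr0n mulr0 addr0 sqrtr_sqr.
rewrite /CC_length.
have m01 : measurable_fun (`[0, 2 / 3] : set R) f.
  rewrite (@itv_bndbnd_setU _ _ _ (BRight 3^-1)) ?bnd_simp ?ltW //.
  apply/measurable_funU => //; split; last exact/measurable_fun_itv_bndo_bndcP.
  exact: measurable_fun_itv_cc m0.
have i02 : 0 <= 2 / 3 :> R by lra.
rewrite (@integral_itv_split R f 0 (2 / 3) 1 f0 i02 (ltW i2) m01); last first.
  exact/measurable_fun_itv_bndo_bndcP.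
rewrite (@integral_itv_split R f 0 3^-1 (2 / 3) f0 (ltW i0) (ltW i1)); last 2 first.
- exact: measurable_fun_itv_cc m0.
- exact/measurable_fun_itv_bndo_bndcP.
by rewrite I0 I1 I2 -!EFinD; congr EFin; field.
Qed.

(** * Power inequalities *)

(** The convex function [z^(1+b)] lies above its tangent at [A], here evaluated at [B]. *)
Lemma powR_sub_le (R : realType) (b A B : R) :
  0 < b -> 0 <= A -> 0 <= B ->
  A * A `^ b - B * B `^ b <= (1 + b) * A `^ b * (A - B).
Proof.
move=> b0 A0 B0.
have p0 : 0 < 1 + b by lra.
have pE z : 0 <= z -> z * z `^ b = z `^ (1 + b).
  move=> z0; rewrite -{1}(powRr1 z0) -powRD //.
  by apply/implyP => /eqP H; rewrite H ltxx in p0.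
(* Young's inequality for [B * A `^ b] with exponents [1 + b], [(1 + b) / b]. *)
have := @conjugate_powR R B (A `^ b) (1 + b) ((1 + b) / b) B0 (powR_ge0 _ _) p0
  (divr_gt0 p0 b0).
have -> : (1 + b)^-1 + ((1 + b) / b)^-1 = 1.
  by field; rewrite !gt_eqF.
move=> /(_ erefl).
rewrite -powRrM; have -> : b * ((1 + b) / b) = 1 + b by field; rewrite gt_eqF.
rewrite !pE // => H.
have := ler_wpM2l (ltW p0) H.
have -> : (1 + b) * (B `^ (1 + b) / (1 + b) + A `^ (1 + b) / ((1 + b) / b)) =
   B `^ (1 + b) + b * A `^ (1 + b) by field; rewrite !gt_eqF.
have := pE _ A0; nra.
Qed.

(** The derivative of [z |z|^b] is [(1+b) |z|^b], at most [(1+b) S^b] on [[-S, S]]. For equal signs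
    this is the tangent inequality; for opposite signs both powers are at most [S^b]. *)
Lemma signed_powR_sub_le (R : realType) (b S A B : R) :
  0 < b -> `|A| <= S -> `|B| <= S ->
  `|A * `|A| `^ b - B * `|B| `^ b| <= (1 + b) * S `^ b * `|A - B|.
Proof.
move=> b0.
have mono z : `|z| <= S -> `|z| `^ b <= S `^ b.
  move=> zS; have S0 := le_trans (normr_ge0 z) zS.
  by apply: ge0_ler_powR => //; rewrite ?nnegrE // ltW.
have opp z : (- z) * `|- z| `^ b = - (z * `|z| `^ b) by rewrite normrN mulNr.
wlog AB : A B / B <= A.
  move=> H AS BS; have [/H|/ltW/H] := leP B A; first exact.
  by rewrite distrC [`|A - B|]distrC; exact.
(* The map is odd, so replacing [(A, B)] by [(- B, - A)] keeps the order and the inequality. *)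
wlog A0 : A B AB / 0 <= A.
  move=> H AS BS; have [/(H A B AB)|A0] := leP 0 A; first exact.
  have := H (- B) (- A); rewrite !opp !normrN.
  have -> : - (B * `|B| `^ b) - (- (A * `|A| `^ b)) =
      A * `|A| `^ b - B * `|B| `^ b by ring.
  have -> : - B - (- A) = A - B by ring.
  by apply; lra.
move=> /[dup] AS /mono mA /[dup] BS /mono mB.
rewrite [in leRHS]ger0_norm ?subr_ge0 //.
have S0 := powR_ge0 S b.
have [B0|B0] := leP 0 B.
  rewrite (ger0_norm A0) (ger0_norm B0) in mA mB *.
  have BA : B `^ b <= A `^ b by apply: (ge0_ler_powR (ltW b0)); rewrite ?nnegrE.
  have := powR_ge0 B b => Bb0.
  rewrite ger0_norm; last by nra.
  apply: le_trans (powR_sub_le b0 A0 B0) _.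
  by rewrite ler_wpM2r ?subr_ge0 // ler_wpM2l //; lra.
have Ab0 := powR_ge0 `|A| b; have Bb0 := powR_ge0 `|B| b.
rewrite ger0_norm; last by nra.
apply: le_trans (_ : S `^ b * (A - B) <= _); first by nra.
rewrite ler_wpM2r ?subr_ge0 //; nra.
Qed.

(** The hypothesis puts the image of [B] closer to that of [A] than 0 is, which forces equal signs.
    For nonnegative [A] and [B] it remains to compare [B A^b] with [B B^b], by monotonicity of
    powers. *)
Lemma signed_powR_sub_ge (R : realType) (b A B : R) :
  0 < b -> `|B * `|B| `^ b - A * `|A| `^ b| < `|A * `|A| `^ b| ->
  `|A| `^ b * `|B - A| <= `|B * `|B| `^ b - A * `|A| `^ b|.
Proof.
move=> b0.
wlog A0 : A B / 0 <= A.
  move=> H; have [/(H A B)|A0] := leP 0 A; first exact.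
  have := H (- A) (- B); rewrite !normrN.
  have -> : - B * `|B| `^ b - (- A * `|A| `^ b) =
      - (B * `|B| `^ b - A * `|A| `^ b) by ring.
  have -> : - B - (- A) = - (B - A) by ring.
  by rewrite mulNr !normrN; apply; lra.
have Ab0 := powR_ge0 `|A| b; have Bb0 := powR_ge0 `|B| b.
have AA : 0 <= A * `|A| `^ b by rewrite mulr_ge0.
rewrite (ger0_norm AA).
have [B0|B0] := leP 0 B; last first.
  rewrite ler0_norm; last by nra.
  by nra.
have [AB|/ltW BA] := leP A B.
  have mono : `|A| `^ b <= `|B| `^ b.
    by apply: (ge0_ler_powR (ltW b0)); rewrite ?nnegrE // !ger0_norm.
  rewrite [`|B - A|]ger0_norm ?subr_ge0 // => _.
  have := ler_wpM2l B0 mono; have := ler_wpM2r Ab0 AB => h1 h2.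
  by rewrite [leRHS]ger0_norm; lra.
have mono : `|B| `^ b <= `|A| `^ b.
  by apply: (ge0_ler_powR (ltW b0)); rewrite ?nnegrE // !ger0_norm.
rewrite [`|B - A|]ler0_norm ?subr_le0 // => _.
have := ler_wpM2l B0 mono; have := ler_wpM2r Ab0 BA => h1 h2.
by rewrite [leRHS]ler0_norm; lra.
Qed.

(* In the coordinate [u = x * `|x| `^ b] this is [D * max (`|u|, D) `^ (- t)] with
   [t = b / (1 + b)]: the size of a Euclidean step [D] starting at [u], measured
   in the conformal metric [`|u| `^ (- t) * |dz|]. *)
Definition grushin_scale (R : realType) (b X D : R) : R :=
  D * (Num.max X (D `^ (1 + b)^-1)) `^ (- b).

Lemma powR1D_root (R : realType) (b D : R) :
  0 < b -> 0 <= D -> (D `^ (1 + b)^-1) `^ (1 + b) = D.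
Proof.
by move=> b0 D0; rewrite -powRrM mulVf ?powRr1 // gt_eqF //; lra.
Qed.

Lemma powR1D (R : realType) (b z : R) :
  0 < b -> 0 <= z -> z `^ (1 + b) = z * z `^ b.
Proof.
move=> b0 z0; rewrite -{2}(powRr1 z0) -powRD //.
by apply/implyP => /eqP H; lra.
Qed.

Lemma grushin_scale_gt0 (R : realType) (b X D : R) :
  0 < D -> 0 < grushin_scale b X D.
Proof.
by move=> D0; rewrite mulr_gt0 // powR_gt0 // lt_max powR_gt0 // orbT.
Qed.

(** Let [m] be the maximum in the scale. If [L <= m], then [X + L <= 2 m] in the hypothesis. If
    [L > m], then [D <= m^(1+b)], so the scale is at most [m < L]. *)
Lemma grushin_scale_le (R : realType) (b X D L : R) :
  0 < b -> 0 <= X -> 0 < D -> 0 <= L ->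
  D <= (1 + b) * (X + L) `^ b * L ->
  grushin_scale b X D <= (1 + b) * 2 `^ b * L.
Proof.
move=> b0 X0 D0 L0 DL; rewrite /grushin_scale.
set r := D `^ _; set m := Num.max X r.
have r0 : 0 < r by exact: powR_gt0.
have m0 : 0 < m by rewrite lt_max r0 orbT.
have rm : r <= m by rewrite le_max lexx orbT.
have Xm : X <= m by rewrite le_max lexx.
have mb0 := powR_gt0 b m0.
rewrite powRN ler_pdivrMr //.
have two0 := powR_ge0 (2 : R) b.
have two1 : 1 <= (2 : R) `^ b.
  by rewrite -[leLHS](powRr0 2); apply: ler_powR; rewrite ?ler1n // ltW.
have [Lm|mL] := leP L m.
  apply: le_trans DL _.
  have : (X + L) `^ b <= 2 `^ b * m `^ b.
    rewrite -powRM ?(ltW m0) //; apply: (ge0_ler_powR (ltW b0)); rewrite ?nnegrE.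
    - by rewrite addr_ge0.
    - by rewrite mulr_ge0 // ltW.
    - lra.
  move=> /(ler_wpM2r L0) h.
  have p0 : 0 <= 1 + b by lra.
  by have := ler_wpM2l p0 h; lra.
have Dm : D <= m * m `^ b.
  rewrite -powR1D // ?(ltW m0) // -[leLHS](powR1D_root b0 (ltW D0)).
  by apply: ge0_ler_powR; rewrite ?nnegrE ?(ltW r0) ?(ltW m0) //; lra.
apply: le_trans Dm _; rewrite ler_wpM2r ?(ltW mb0) //.
have : L <= (2 : R) `^ b * L by rewrite ler_peMl.
by nra.
Qed.

(** Far from the axis relative to [D], take [c = x1]: the two remaining legs cost at most
    [D / |x1|^b] each. Otherwise take [c = r = D^(1/(1+b))]: the scale is [r] and the legs cost at
    most [2 r], [r] and [3 r], whence the 6. *)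
Lemma grushin_scale_ge (R : realType) (b x1 x2 dy D : R) :
  0 < b -> 0 < D ->
  `|x2 * `|x2| `^ b - x1 * `|x1| `^ b| <= D -> `|dy| <= D ->
  exists2 c, c != 0 &
    `|c - x1| + `|c| `^ (- b) * `|dy| + `|x2 - c| <= 6 * grushin_scale b `|x1| D.
Proof.
move=> b0 D0 uD yD; rewrite /grushin_scale.
set r := D `^ _.
have r0 : 0 < r by exact: powR_gt0.
have rD : r * r `^ b = D by rewrite -powR1D ?(ltW r0) // powR1D_root // ltW.
have [Dx|xD] := ltP D (`|x1| `^ (1 + b)).
  have x0 : x1 != 0.
    apply/eqP => x0; move: Dx.
    by rewrite x0 normr0 powR0 ?(le_gtF (ltW D0)) // gt_eqF //; lra.
  have X0 : 0 < `|x1| by rewrite normr_gt0.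
  have Xb0 := powR_gt0 b X0.
  have rx : r <= `|x1|.
    rewrite leNgt; apply/negP => xr; move: Dx; apply/negP; rewrite -leNgt.
    rewrite -[leRHS](powR1D_root b0 (ltW D0)).
    by apply: ge0_ler_powR; rewrite ?nnegrE ?normr_ge0 ?(ltW xr) ?(ltW r0) //; lra.
  exists x1 => //.
  rewrite (max_idPl rx) subrr normr0 add0r powRN.
  have Dx' : `|x2 * `|x2| `^ b - x1 * `|x1| `^ b| < `|x1 * `|x1| `^ b|.
    apply: le_lt_trans uD _.
    by rewrite normrM [`|_ `^ b|]ger0_norm ?powR_ge0 // -powR1D.
  have := signed_powR_sub_ge b0 Dx' => /le_trans /(_ uD).
  rewrite mulrC -ler_pdivlMr // => h1.
  have h2 : (`|x1| `^ b)^-1 * `|dy| <= D / `|x1| `^ b.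
    by rewrite mulrC ler_wpM2r // invr_ge0 ltW.
  have h3 : 0 <= D / `|x1| `^ b by rewrite divr_ge0 ?ltW.
  lra.
have rb0 := powR_gt0 b r0.
have xr : `|x1| <= r.
  rewrite leNgt; apply/negP => rx; move: xD; apply/negP; rewrite -ltNge.
  rewrite -[ltLHS](powR1D_root b0 (ltW D0)).
  by apply: gt0_ltr_powR; rewrite ?nnegrE ?normr_ge0 ?(ltW r0) //; lra.
exists r; first by rewrite gt_eqF.
rewrite (max_idPr xr) (ger0_norm (ltW r0)) powRN.
have -> : D / r `^ b = r by rewrite -[in LHS]rD mulfK // gt_eqF.
have h1 : (r `^ b)^-1 * `|dy| <= r.
  by rewrite mulrC ler_pdivrMr // rD.
(* Otherwise the image of [x2] would exceed [2 r r^b = 2 D] in absolute value, yet it is within [D]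
   of the image of [x1], itself at most [D]. *)
have h2 : `|x2| <= 2 * r.
  rewrite leNgt; apply/negP => rx.
  have u2 : `|x2 * `|x2| `^ b| = `|x2| * `|x2| `^ b.
    by rewrite normrM [`|_ `^ b|]ger0_norm ?powR_ge0.
  have u1 : `|x1 * `|x1| `^ b| <= D.
    by rewrite normrM [`|_ `^ b|]ger0_norm ?powR_ge0 // -powR1D.
  have rb : r `^ b <= `|x2| `^ b.
    apply: (ge0_ler_powR (ltW b0)); rewrite ?nnegrE ?normr_ge0 ?(ltW r0) //; lra.
  have := lerB_dist (x2 * `|x2| `^ b) (x1 * `|x1| `^ b).
  rewrite u2; have := powR_ge0 `|x2| b.
  by nra.
have h3 : `|x2 - r| <= 3 * r.
  by apply: le_trans (ler_normB _ _) _; rewrite (ger0_norm (ltW r0)); lra.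
have h4 : `|r - x1| <= 2 * r.
  by apply: le_trans (ler_normB _ _) _; rewrite (ger0_norm (ltW r0)); lra.
lra.
Qed.

(** If [D3 <= D2], the maximum for [D3] is the smaller one and [D3 <= T D2] follows. Otherwise write
    [D3 = q^(1+b) D2] with [q >= 1]: the maximum grows by at most [q], so the scale grows by at
    least [q^(1+b) q^(-b) = q], and [q <= T]. *)
Lemma grushin_scale_ratio (R : realType) (b X D2 D3 T : R) :
  0 < b -> 0 <= X -> 0 < D2 -> 0 < D3 -> 0 < T ->
  grushin_scale b X D3 <= T * grushin_scale b X D2 ->
  D3 / D2 <= Num.max T (T `^ (1 + b)).
Proof.
move=> b0 X0 D20 D30 T0; rewrite /grushin_scale.
set r2 := D2 `^ _; set r3 := D3 `^ _; set m2 := Num.max _ r2; set m3 := Num.max _ r3.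
have p0 : 0 < 1 + b by lra.
have r20 : 0 < r2 by exact: powR_gt0.
have r30 : 0 < r3 by exact: powR_gt0.
have m20 : 0 < m2 by rewrite lt_max r20 orbT.
have m30 : 0 < m3 by rewrite lt_max r30 orbT.
have n20 := powR_gt0 b m20; have n30 := powR_gt0 b m30.
rewrite !powRN ler_pdivrMr // => H.
rewrite le_max; apply/orP.
have [D32|/ltW D23] := leP D3 D2.
  left; rewrite ler_pdivrMr //; apply: le_trans H _.
  rewrite -!mulrA ler_pM2l // ler_piMr ?(ltW D20) //.
  rewrite (ler_pdivrMl _ _ n20) mulr1.
  have r32 : r3 <= r2.
    by apply: ge0_ler_powR; rewrite ?nnegrE ?invr_ge0 ?(ltW p0) ?(ltW D20) ?(ltW D30).
  apply: (ge0_ler_powR (ltW b0)); rewrite ?nnegrE ?(ltW m20) ?(ltW m30) //.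
  by rewrite /m3 /m2 ge_max !le_max lexx r32 orbT.
right.
pose q := (D3 / D2) `^ (1 + b)^-1.
have q0 : 0 < q by rewrite powR_gt0 // divr_gt0.
have q1 : 1 <= q.
  apply: le_trans (_ : 1 `^ (1 + b)^-1 <= _); first by rewrite powR1.
  apply: ge0_ler_powR; rewrite ?nnegrE ?invr_ge0 ?(ltW p0) //.
    by rewrite ltW // divr_gt0.
  by rewrite ler_pdivlMr // mul1r.
have qD : q `^ (1 + b) = D3 / D2 by apply: powR1D_root => //; rewrite ltW // divr_gt0.
have r3q : r3 = q * r2.
  rewrite /q /r2 -powRM ?(ltW D20) ?divfK ?gt_eqF //.
  by rewrite ltW // divr_gt0.
have m3q : m3 <= q * m2.
  rewrite /m3 r3q ge_max; apply/andP; split.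
    apply: le_trans (ler_peMl (ltW m20) q1); by rewrite le_max lexx.
  by rewrite ler_pM2l // le_max lexx orbT.
have n3q : m3 `^ b <= q `^ b * m2 `^ b.
  rewrite -powRM ?(ltW q0) ?(ltW m20) //; apply: (ge0_ler_powR (ltW b0)) => //.
    by rewrite nnegrE ltW.
  by rewrite nnegrE mulr_ge0 // ltW.
have qT : q <= T.
  have qb0 := powR_gt0 b q0.
  have E : D3 = q * q `^ b * D2 by rewrite -powR1D ?(ltW q0) // qD divfK // gt_eqF.
  have H1 : D3 <= T * (q `^ b * D2).
    apply: le_trans H _.
    rewrite -mulrA (ler_pM2l T0) mulrAC (ler_pdivrMr _ _ n20).
    by rewrite [q `^ b * D2]mulrC -mulrA (ler_pM2l D20).
  by move: H1; rewrite {1}E -mulrA ler_pM2r // mulr_gt0.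
rewrite -qD; apply: ge0_ler_powR; rewrite ?nnegrE ?(ltW p0) ?(ltW q0) ?(ltW T0) //.
Qed.

(** * Comparison of the distances *)

(** Bounds on this distance split into one per coordinate, at the price of a factor 2 against the
    Euclidean one. *)
Definition sup_dist (R : realType) (p q : R * R) : R :=
  Num.max `|p.1 - q.1| `|p.2 - q.2|.

Lemma euclidean_dist_sup (R : realType) (p q : R * R) :
  sup_dist p q <= euclidean_dist p q <= 2 * sup_dist p q.
Proof.
rewrite /sup_dist /euclidean_dist; set a := p.1 - q.1; set b := p.2 - q.2.
have aM : `|a| <= Num.max `|a| `|b| by rewrite le_max lexx.
have bM : `|b| <= Num.max `|a| `|b| by rewrite le_max lexx orbT.
apply/andP; split.
  by rewrite ge_max -!sqrtr_sqr !ler_wsqrtr // ?lerDl ?lerDr sqr_ge0.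
set m := Num.max _ _ in aM bM *.
have m0 : 0 <= m by exact: le_trans aM.
rewrite -[leRHS]ger0_norm ?mulr_ge0 // -sqrtr_sqr ler_wsqrtr //.
rewrite -(real_normK (num_real a)) -(real_normK (num_real b)).
have := normr_ge0 a; have := normr_ge0 b; nra.
Qed.

Lemma grushin_map_inj (R : realType) (alpha : R) :
  0 < alpha -> injective (grushin_map alpha).
Proof.
move=> alpha0 [x1 y1] [x2 y2] [ux ->]; congr (_, _).
have b0 : 0 < alpha / 2 by rewrite divr_gt0.
have [x10|x10] := eqVneq x1 0.
  apply/esym/eqP; move/esym/eqP: ux; rewrite x10 mul0r mulf_eq0 powR_eq0 normr_eq0.
  by case/orP => // /andP[].
have := @signed_powR_sub_ge _ _ x1 x2 b0.
rewrite -ux subrr normr0 normr_gt0 mulf_neq0 //; last first.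
  by rewrite powR_eq0 normr_eq0 negb_and x10.
move=> /(_ isT); rewrite pmulr_rle0; last by rewrite powR_gt0 // normr_gt0.
by rewrite normr_le0 subr_eq0 => /eqP.
Qed.

Lemma CC_dist_scale (R : realType) (alpha : R) (g h : R * R) :
  0 < alpha ->
  let b := alpha / 2 in
  let D := sup_dist (grushin_map alpha g) (grushin_map alpha h) in
  0 < D ->
  CC_dist alpha g h <= 6 * grushin_scale b `|h.1| D /\
  grushin_scale b `|h.1| D <= (1 + b) * 2 `^ b * 2 * CC_dist alpha g h.
Proof.
move=> alpha0 b D D0.
have b0 : 0 < b by rewrite divr_gt0.
have two0 : 0 < (2 : R) `^ b by rewrite powR_gt0.
have K0 : 0 < (1 + b) * 2 `^ b * 2 by rewrite !mulr_gt0 //; lra.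
set s := grushin_scale b _ D.
have le6 : (CC_edist alpha g h <= (6 * s)%:E)%E.
  have uD : `|g.1 * `|g.1| `^ b - h.1 * `|h.1| `^ b| <= D by rewrite le_max lexx.
  have yD : `|h.2 - g.2| <= D by rewrite distrC le_max lexx orbT.
  have [c c0 H] := grushin_scale_ge b0 D0 uD yD.
  have [x [y [Hxy L]]] := horizontal_curve_detour alpha g h c0.
  apply: ge_ereal_inf; exists (CC_length alpha x y); first by exists x, y.
  rewrite L lee_fin; apply: le_trans H.
  by rewrite [`|c - g.1|]distrC [`|h.1 - c|]distrC; lra.
have geK : ((s / ((1 + b) * 2 `^ b * 2))%:E <= CC_edist alpha g h)%E.
  apply: le_ereal_inf_tmp => _ [x [y [Hxy ->]]].
  case L : (CC_length alpha x y) => [l| |]; last 2 first.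
  - exact: leey.
  - have : (0 <= CC_length alpha x y)%E.
      by apply: integral_ge0 => t _; rewrite lee_fin sqrtr_ge0.
    by rewrite L.
  have [l0 xl yl] := horizontal_curve_bounds alpha0 Hxy L.
  rewrite lee_fin ler_pdivrMr // [leRHS]mulrC -(mulrA _ 2 l).
  (* The vertical bound is based at [g], the scale at [h]. Since [|g.1| <= |h.1| + l], the change of
     base is paid by taking [L = 2 l]. *)
  rewrite /s; apply: grushin_scale_le => //; first by rewrite mulr_ge0.
  have gl : `|g.1| <= `|h.1| + l.
    by have := lerB_dist g.1 h.1; rewrite distrC in xl; lra.
  rewrite ge_max; apply/andP; split.
    apply: le_trans (@signed_powR_sub_le _ b (`|h.1| + 2 * l) g.1 h.1 b0 _ _) _.
    - lra.
    - lra.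
    rewrite ler_wpM2l ?mulr_ge0 ?powR_ge0 //; first lra.
    by rewrite distrC; lra.
  rewrite distrC; apply: le_trans yl _.
  have : (`|g.1| + l) `^ b <= (`|h.1| + 2 * l) `^ b.
    apply: (ge0_ler_powR (ltW b0)); rewrite ?nnegrE ?addr_ge0 ?mulr_ge0 //; lra.
  have := powR_ge0 (`|h.1| + 2 * l) b.
  move: (_ `^ b) => P P0 /(ler_wpM2r l0) /le_trans; apply.
  have : 0 <= P * l by rewrite mulr_ge0.
  have : 0 <= b * (P * l) by rewrite !mulr_ge0 // ltW.
  lra.
(* The two bounds exclude the infinite values, so they survive [fine]. *)
rewrite /CC_dist; case: (CC_edist alpha g h) le6 geK => [d| |] //=.
rewrite !lee_fin => d6 dK; split => //.
by move: dK; rewrite ler_pdivrMr // mulrC.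
Qed.

(** * The distortion function and the conclusion *)

Lemma continuous_powR_gt0 (R : realType) (p t : R) :
  0 < t -> {for t, continuous (fun z : R => z `^ p)}.
Proof.
move=> t0; apply: differentiable_continuous; apply/derivable1_diffP.
by apply: derivable_powR; rewrite in_itv/= t0.
Qed.

(** The inverse of a maximum of two increasing bijections is the minimum of their inverses. *)
Lemma increasing_homeo_max_powR (R : realType) (C p : R) :
  0 < C -> 0 < p ->
  increasing_homeo_pos (fun t => Num.max (C * t) ((C * t) `^ p)).
Proof.
move=> C0 p0; exists (fun s => Num.min s (s `^ p^-1) / C).
have pK (z : R) : 0 <= z -> (z `^ p) `^ p^-1 = z.
  by move=> z0; rewrite -powRrM divff ?powRr1 // gt_eqF.
have pVK (z : R) : 0 <= z -> (z `^ p^-1) `^ p = z.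
  by move=> z0; rewrite -powRrM mulVf ?powRr1 // gt_eqF.
have pV0 : 0 < p^-1 by rewrite invr_gt0.
have cmul (k t : R) : {for t, continuous (fun z : R => k * z)}.
  by apply: cvgMr; exact: cvg_id.
split; split.
- by move=> t t0 /=; rewrite lt_max mulr_gt0.
- by move=> s s0 /=; rewrite divr_gt0 // lt_min s0 powR_gt0.
- move=> t t0; have Ct0 : 0 < C * t by rewrite mulr_gt0.
  suff -> : Num.min (Num.max (C * t) ((C * t) `^ p))
      (Num.max (C * t) ((C * t) `^ p) `^ p^-1) = C * t.
    by rewrite [C * t]mulrC mulfK // gt_eqF.
  have [le1|lt1] := leP (C * t) ((C * t) `^ p).
    by rewrite pK ?(ltW Ct0) // (min_idPr le1).
  apply/min_idPl; rewrite -[leLHS](pK _ (ltW Ct0)).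
  apply: (ge0_ler_powR (ltW pV0)); rewrite ?nnegrE ?powR_ge0 ?(ltW Ct0) //.
  exact: ltW.
- move=> s s0; rewrite (mulrC C) divfK ?gt_eqF //.
  have [le1|lt1] := leP s (s `^ p^-1).
    rewrite max_l // -[leRHS]pVK ?(ltW s0) //.
    by apply: (ge0_ler_powR (ltW p0)); rewrite ?nnegrE ?powR_ge0 ?(ltW s0).
  by rewrite pVK ?(ltW s0) // max_r // ltW.
- move=> s t s0 st; have Cst : C * s < C * t by rewrite ltr_pM2l.
  have Cs0 : 0 < C * s by rewrite mulr_gt0.
  rewrite gt_max !lt_max Cst gt0_ltr_powR ?orbT // nnegrE ltW //.
  exact: lt_trans Cst.
- apply: continuous_in_subspaceT => t; rewrite inE /= in_itv/= andbT => t0.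
  apply: (@continuous_max R R (fun z => C * z) (fun z => (C * z) `^ p)).
    exact: cmul.
  apply: (@continuous_comp _ _ _ (fun z => C * z) (fun z => z `^ p)).
    exact: cmul.
  by apply: continuous_powR_gt0; rewrite mulr_gt0.
- apply: continuous_in_subspaceT => t; rewrite inE /= in_itv/= andbT => t0.
  apply: cvgMl.
  apply: (@continuous_min R R id (fun z => z `^ p^-1)); first exact: cvg_id.
  exact: continuous_powR_gt0.
Qed.

Lemma ler_ratio_trans (R : realFieldType) (k m s2 s3 d2 d3 : R) :
  0 < k -> 0 < d2 -> 0 < d3 -> s3 <= k * d3 -> d2 <= m * s2 ->
  s3 <= k * m * (d3 / d2) * s2.
Proof.
move=> k0 d20 d30 s3d d2s; apply: le_trans s3d _.
have q0 : 0 <= k * (d3 / d2) by rewrite mulr_ge0 ?divr_ge0 ?ltW.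
have -> : k * d3 = k * (d3 / d2) * d2 by rewrite -mulrA divfK // gt_eqF.
have -> : k * m * (d3 / d2) * s2 = k * (d3 / d2) * (m * s2) by ring.
exact: ler_wpM2l.
Qed.

(** Moves the factor 2 between sup and Euclidean distances into the argument of [eta], using
    [2 <= 2^(1+b)]. *)
Lemma double_max_powR_le (R : realType) (b T : R) :
  0 <= b -> 0 <= T ->
  2 * Num.max T (T `^ (1 + b)) <= Num.max (2 * T) ((2 * T) `^ (1 + b)).
Proof.
move=> b0 T0; have two1 : 2 <= (2 : R) `^ (1 + b).
  by apply: le1r_powR; lra.
rewrite maxr_pMr // ge_max !le_max lexx /= powRM //.
by rewrite ler_wpM2r ?powR_ge0 ?orbT.
Qed.

Theorem theorem14 (R : realType) (alpha : R) (alpha_gt0 : 0 < alpha) :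
  quasisymmetric (CC_dist alpha) (@euclidean_dist R) (grushin_map alpha).
Proof.
have inj := grushin_map_inj alpha_gt0.
pose b := alpha / 2.
have b0 : 0 < b by rewrite divr_gt0.
pose K := (1 + b) * 2 `^ b * 2 : R.
have K0 : 0 < K by rewrite !mulr_gt0 ?powR_gt0 //; lra.
have p0 : 0 < 1 + b by lra.
(* [K] and 6 are the constants of [CC_dist_scale]; 2 comes from [euclidean_dist_sup]. *)
pose C := 2 * (K * 6).
have C0 : 0 < C by rewrite !mulr_gt0.
exists (fun t => Num.max (C * t) ((C * t) `^ (1 + b))); split.
  exact: increasing_homeo_max_powR.
split => // z1 z2 z3 z21 z31.
have sup_gt0 z : z <> z1 -> 0 < sup_dist (grushin_map alpha z) (grushin_map alpha z1).
  move=> zz1; rewrite lt_max !normr_gt0 !subr_eq0.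
  apply/negPn/negP; rewrite negb_or !negbK => /andP[/eqP e1 /eqP e2].
  by apply: zz1; apply: inj; rewrite [LHS]surjective_pairing e1 e2 -surjective_pairing.
have D20 := sup_gt0 _ z21; have D30 := sup_gt0 _ z31.
have [d2le d2ge] := CC_dist_scale alpha_gt0 D20.
have [d3le d3ge] := CC_dist_scale alpha_gt0 D30.
have /andP[E2 _] := euclidean_dist_sup (grushin_map alpha z2) (grushin_map alpha z1).
have /andP[_ E3] := euclidean_dist_sup (grushin_map alpha z3) (grushin_map alpha z1).
rewrite -/b in d2le d2ge d3le d3ge.
set D2 := sup_dist (_ z2) _ in D20 d2le d2ge E2.
set D3 := sup_dist (_ z3) _ in D30 d3le d3ge E3.
have s20 := grushin_scale_gt0 b `|z1.1| D20.
have s30 := grushin_scale_gt0 b `|z1.1| D30.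
set d2 := CC_dist _ z2 _ in d2le d2ge *; set d3 := CC_dist _ z3 _ in d3le d3ge *.
have d20 : 0 < d2 by rewrite -(pmulr_rgt0 _ K0) (lt_le_trans s20).
have d30 : 0 < d3 by rewrite -(pmulr_rgt0 _ K0) (lt_le_trans s30).
pose t := d3 / d2; have t0 : 0 < t by rewrite divr_gt0.
pose T := K * 6 * t; have T0 : 0 < T by apply: mulr_gt0 => //; rewrite mulr_gt0.
have ratio : grushin_scale b `|z1.1| D3 <= T * grushin_scale b `|z1.1| D2.
  exact: ler_ratio_trans K0 d20 d30 d3ge d2le.
have := grushin_scale_ratio b0 (normr_ge0 z1.1) D20 D30 T0 ratio.
rewrite -/t (_ : C * t = 2 * T); last by rewrite /C /T !mulrA.
set m := Num.max T _ => D32.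
have m2 := double_max_powR_le (ltW b0) (ltW T0).
(* The Euclidean numerator is at most [2 * D3] and the denominator at least [D2]. *)
apply: le_trans m2; apply: le_trans (_ : 2 * (D3 / D2) <= _); last by rewrite ler_pM2l.
rewrite mulrA; apply: ler_pM => //.
- exact: sqrtr_ge0.
- by rewrite invr_ge0 sqrtr_ge0.
- by rewrite lef_pV2 // posrE; exact: lt_le_trans E2.
Qed.
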